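(* For a design $0=s_1<\dots<s_n=1$ (depending on $n$) with spacings $\Delta_i=s_i-s_{i-1}$, $i=2,\dots,n$, let $$\tau_n^2=\frac{2}{n}\sum_{i=3}^{n-1}\left[\left(\frac{\Delta_{i+1}}{\Delta_i+\Delta_{i+1}}+\frac{\Delta_{i-1}}{\Delta_i+\Delta_{i-1}}\right)^2+2\,\frac{\Delta_i\Delta_{i+1}}{(\Delta_i+\Delta_{i+1})^2}\right].$$ (i) Let $\{s_1,\dots,s_n\}$ be such that $s_1=0$, for $i=2,\dots,n-1$, $$\Delta_i=\begin{cases}(1-\gamma_n)\frac{2}{n}&\text{if } i \text{ is even},\\ \frac{2\gamma_n}{n}&\text{if } i\text{ is odd},\end{cases}$$ where $\gamma_n\in(0,1)$, and $\Delta_n=1-\sum_{i=2}^{n-1}\Delta_i$. Then, taking $\gamma_n=1/n$, we get $\tau_n^2\to4$ as $n\to\infty$. (ii) Let $0<\alpha<1$ and, for $n$ large enough that $\lfloor n^\alpha\rfloor\ge2$, let $\{s_1,\dots,s_n\}$ be such that $s_1=0$, $\Delta_i=1/(i!)$ for $i=\lfloor n^\alpha\rfloor+1,\dots,n$, and $\Delta_2=\dots=\Delta_{\lfloor n^\alpha\rfloor}=(1-r_n)/(\lfloor n^\alpha\rfloor-1)$ with $r_n:=\sum_{i=\lfloor n^\alpha\rfloor+1}^n\Delta_i$. Then $\sum_{i=2}^n\Delta_i=1$ and $\tau_n^2\to2$ as $n\to\infty$.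
   Context: The spacings $\Delta_i$ form a triangular array; their dependence on $n$ is not written. $\lfloor x\rfloor$ is the integer part of $x$. *)

(* Defs.v *)
From HB Require Import structures.
From mathcomp Require Import all_boot all_order all_algebra.
From mathcomp Require Import all_classical all_reals all_analysis.

Set Implicit Arguments.
Unset Strict Implicit.
Unset Printing Implicit Defensive.

Import Order.TTheory GRing.Theory Num.Theory.
Import numFieldNormedType.Exports.

Local Open Scope ring_scope.

(* The points s_1, ..., s_n are the values s 1, ..., s n of s : nat -> R; the
   values of s outside {1, ..., n} play no role. *)

Definition design (R : realType) (n : nat) (s : nat -> R) : Prop :=
  [/\ s 1%N = 0, s n = 1 & forall i, (1 <= i < n)%N -> s i < s i.+1].

(* Only used for 2 <= i <= n. *)
Definition spacing (R : realType) (s : nat -> R) (i : nat) : R :=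
  s i - s i.-1.

Definition tau2 (R : realType) (n : nat) (s : nat -> R) : R :=
  let D := spacing s in
  2 / n%:R *
  \sum_(3 <= i < n)
     ((D i.+1 / (D i + D i.+1) + D i.-1 / (D i + D i.-1)) ^+ 2
      + 2 * (D i * D i.+1 / (D i + D i.+1) ^+ 2)).

Definition alternating_points (R : realType) (n : nat) (gamma : R)
    (s : nat -> R) : Prop :=
  [/\ s 1%N = 0,
      forall i, (2 <= i < n)%N ->
        spacing s i = if odd i then 2 * gamma / n%:R
                      else (1 - gamma) * (2 / n%:R)
    & spacing s n = 1 - \sum_(2 <= i < n) spacing s i].

Definition floor_power (R : realType) (alpha : R) (n : nat) : nat :=
  Num.truncn (n%:R `^ alpha).

(* m stands for the integer part of n ^ alpha. *)
Definition factorial_points (R : realType) (n m : nat) (s : nat -> R) : Prop :=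
  let r := \sum_(m.+1 <= i < n.+1) spacing s i in
  [/\ s 1%N = 0,
      forall i, (m.+1 <= i <= n)%N -> spacing s i = 1 / (i`!)%:R
    & forall i, (2 <= i <= m)%N -> spacing s i = (1 - r) / (m%:R - 1)].

(* Main.v *)
Require Import Defs.
From HB Require Import structures.
From mathcomp Require Import all_boot all_order all_algebra.
From mathcomp Require Import all_classical all_reals all_analysis.
From mathcomp Require Import ring lra zify.

Set Implicit Arguments.
Unset Strict Implicit.
Unset Printing Implicit Defensive.

Import Order.TTheory GRing.Theory Num.Theory.
Import numFieldNormedType.Exports.

Local Open Scope classical_set_scope.
Local Open Scope ring_scope.

(* Put x = D_{i+1} / (D_i + D_{i+1}) and y = D_{i-1} / (D_i + D_{i-1}), both
   in [0, 1]: the i-th summand of tau_n^2 is (x + y)^2 + 2 x (1 - x), which lies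
   in [0, 6], so that o(n) summands do not affect the limit.
   (i) x = y = gamma_n for i even and x = y = 1 - gamma_n for i odd (except for
   i = n - 1): the summands are close to 0 and 4 alternately, with mean 2.
   (ii) For i beyond m = floor (n^alpha), x = 1 / (i + 2) and y = i / (i + 1):
   the summands are 1 + O(1/m), while the first m of them are negligible because
   alpha < 1. *)

(** * Convergence from a power rate *)

Section PowerRate.
Variable R : realType.

Lemma near_powR_ge (a M : R) : 0 < a ->
  \forall n \near \oo, M <= n%:R `^ a.
Proof.
move=> a0; near=> n.
have Mn : `|M| `^ a^-1 <= n%:R by near: n; exact: nbhs_infty_ger.
apply: (le_trans (ler_norm M)).
have -> : `|M| = (`|M| `^ a^-1) `^ a by rewrite -powRrM mulVf ?gt_eqF// powRr1.
by apply: ge0_ler_powR Mn; rewrite ?nnegrE ?powR_ge0// ltW.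
Unshelve. all: by end_near. Qed.

(** Reduces both limits to explicit error bounds: [b] is 1 in (i) and the smaller of [alpha] and
    [1 - alpha] in (ii). *)
Lemma cvg_power_rate (u : nat -> R) (l C b : R) : 0 < b ->
  (\forall n \near \oo, `|u n - l| <= C / n%:R `^ b) -> u @ \oo --> l.
Proof.
move=> b0 uC; apply/cvgrPdist_le => e e0; near=> n.
rewrite distrC; apply: (@le_trans _ _ (C / n%:R `^ b)); first by near: n.
have n0 : 0 < n%:R `^ b :> R.
  by apply: (@lt_le_trans _ _ 1) => //; near: n; exact: near_powR_ge.
rewrite ler_pdivrMr// mulrC -ler_pdivrMr//.
by near: n; exact: near_powR_ge.
Unshelve. all: by end_near. Qed.

End PowerRate.

(** * Designs, the summands of tau_n^2, and a general error estimate *)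

Section Design.
Variable R : realType.
Implicit Types (s D : nat -> R) (n i : nat).

Lemma sum_spacing s n : (2 <= n)%N ->
  \sum_(2 <= i < n.+1) spacing s i = s n - s 1%N.
Proof.
move=> n2; rewrite (telescope_sumr_eq (fun i => s i.-1)) //.
exact: leqW.
Qed.

Lemma design_spacing s n : (2 <= n)%N -> s 1%N = 0 ->
  (forall i, (2 <= i <= n)%N -> 0 < spacing s i) ->
  \sum_(2 <= i < n.+1) spacing s i = 1 -> design n s.
Proof.
move=> n2 s1 s_gt0 sum1; split => //.
  by rewrite -sum1 sum_spacing// s1 subr0.
move=> i ?; rewrite -subr_gt0; apply: (s_gt0 i.+1); lia.
Qed.

Lemma spacing_gt0 s n i : design n s -> (2 <= i <= n)%N -> 0 < spacing s i.
Proof.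
case=> _ _ s_lt; case: i => // i ?; rewrite /spacing subr_gt0.
by apply: s_lt; lia.
Qed.

Definition tau2_term D i : R :=
  (D i.+1 / (D i + D i.+1) + D i.-1 / (D i + D i.-1)) ^+ 2
    + 2 * (D i * D i.+1 / (D i + D i.+1) ^+ 2).

(** The ratios enter through product equations, so that closed forms for them can be checked by
    [ring] or [field]. The factor [1 - x] is [D i / (D i + D i.+1)]. *)
Lemma tau2_termE D i (x y : R) :
  D i + D i.+1 != 0 -> D i + D i.-1 != 0 ->
  D i.+1 = x * (D i + D i.+1) -> D i.-1 = y * (D i + D i.-1) ->
  tau2_term D i = (x + y) ^+ 2 + 2 * (x * (1 - x)).
Proof.
move=> d0 d1 Ex Ey; rewrite /tau2_term.
have -> : x = D i.+1 / (D i + D i.+1) by rewrite {1}Ex mulfK.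
have -> : y = D i.-1 / (D i + D i.-1) by rewrite {1}Ey mulfK.
by field; rewrite d0 d1.
Qed.

(** Both ratios lie in [0, 1], so the square is at most 4 and [2 * (x * (1 - x))] at most 2. *)
Lemma tau2_term_bound s n i : design n s -> (3 <= i < n)%N ->
  0 <= tau2_term (spacing s) i <= 6.
Proof.
move=> ds i3n.
have a0 : 0 < spacing s i.-1 by apply: spacing_gt0 ds _; lia.
have b0 : 0 < spacing s i by apply: spacing_gt0 ds _; lia.
have c0 : 0 < spacing s i.+1 by apply: spacing_gt0 ds _; lia.
pose x := spacing s i.+1 / (spacing s i + spacing s i.+1).
pose y := spacing s i.-1 / (spacing s i + spacing s i.-1).
have bc : 0 < spacing s i + spacing s i.+1 by rewrite addr_gt0.
have ba : 0 < spacing s i + spacing s i.-1 by rewrite addr_gt0.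
have x01 : 0 <= x <= 1.
  by rewrite /x divr_ge0 ?(ltW c0, ltW bc)//=
    ler_pdivrMr// mul1r ltW// ltrDr.
have y01 : 0 <= y <= 1.
  by rewrite /y divr_ge0 ?(ltW a0, ltW ba)//=
    ler_pdivrMr// mul1r ltW// ltrDr.
rewrite (@tau2_termE _ _ x y) ?gt_eqF ?divfK ?gt_eqF//.
by apply/andP; split; nra.
Qed.

(** Error bookkeeping by the triangle inequality: [c] holds the idealized summands, [e] is the
    uniform error, [P] marks at most [N] exceptional indices costing [K] more each, and [A] measures
    how far the idealized sum is from giving exactly [L]. *)
Lemma dist_tau2_le s n (P : pred nat) (N : nat) (c : nat -> R) (e K A L : R) :
  (0 < n)%N -> 0 <= e -> 0 <= K ->
  (forall i, (3 <= i < n)%N ->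
     `|tau2_term (spacing s) i - c i| <= e + K * (P i)%:R) ->
  (\sum_(3 <= i < n) P i <= N)%N ->
  `|2 * \sum_(3 <= i < n) c i - L * n%:R| <= A ->
  `|tau2 n s - L| <= 2 * e + (2 * K * N%:R + A) / n%:R.
Proof.
move=> n0 e0 K0 tc PN cL.
have n0R : 0 < n%:R :> R by rewrite ltr0n.
have -> : tau2 n s - L =
    (2 * \sum_(3 <= i < n) (tau2_term (spacing s) i - c i)
     + (2 * \sum_(3 <= i < n) c i - L * n%:R)) / n%:R.
  rewrite sumrB /tau2 -/(tau2_term _ _).
  by field; rewrite gt_eqF.
rewrite normrM (gtr0_norm (x := n%:R^-1)) ?invr_gt0// ler_pdivrMr//.
rewrite [(2 * e + _) * _]mulrDl divfK ?gt_eqF//.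
apply: (le_trans (ler_normD _ _)); rewrite addrA lerD//.
rewrite normrM ger0_norm// -!mulrA -mulrDr ler_wpM2l//.
apply: (le_trans (ler_norm_sum _ _ _)).
apply: (le_trans (ler_sum_nat tc)).
rewrite big_split /= -mulr_sumr -natr_sum lerD ?ler_wpM2l ?ler_nat//.
rewrite sumr_const_nat -[e *+ _]mulr_natr ler_wpM2l// ler_nat; lia.
Qed.

End Design.

(** * Part (i): alternating spacings *)

Section Alternating.
Variable R : realType.
Implicit Types (s : nat -> R) (n i : nat) (g : R).

(** Each even-odd pair contributes 2; for odd [n] one even index is left over. This serves to show
    that the last spacing is positive. *)
Lemma sum_alternating g n :
  \sum_(2 <= i < n.+2) (if odd i then 2 * g else (1 - g) * 2)
  = n%:R + (if odd n then 1 - 2 * g else 0).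
Proof.
elim: n => [|n IH]; first by rewrite big_geq// addr0.
rewrite big_nat_recr//= IH negbK -natr1.
by case: (odd n) => /=; ring.
Qed.

Lemma alternating_design n g s : (2 <= n)%N -> 0 < g < 1 ->
  alternating_points n g s -> design n s.
Proof.
move=> n2 /andP[g0 g1] [s1 sE snE].
have n0 : 0 < n%:R :> R by rewrite ltr0n; lia.
apply: design_spacing => //; last first.
  by rewrite big_nat_recr//= snE addrC subrK.
move=> i i2n; have [->|ni] := eqVneq i n; last first.
  rewrite sE; last by lia.
  by case: ifP => _; rewrite ?mulr_gt0 ?invr_gt0 ?divr_gt0 ?subr_gt0.
have -> : spacing s n = 1 -
    (\sum_(2 <= i < n) (if odd i then 2 * g else (1 - g) * 2)) / n%:R.
  rewrite snE mulr_suml; congr (_ - _); apply: eq_big_nat => j j2n.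
  by rewrite sE//; case: ifP => // _; rewrite mulrA.
rewrite subr_gt0 ltr_pdivrMr// mul1r.
(* With n = k + 2, the sum is k or k + 1 - 2g, hence below n. *)
case: n n2 {sE snE n0 i2n} => [//|[//|k]] _.
rewrite sum_alternating -!natr1; case: ifP => _; lra.
Qed.

Lemma sum_odd n : (2 <= n)%N -> (\sum_(3 <= i < n) odd i)%N = n./2.-1.
Proof.
elim: n => // n IH; rewrite leq_eqVlt => /orP[/eqP<-|n2].
  by rewrite big_geq.
have [->|n3] := eqVneq n 2%N; first by rewrite big_geq.
rewrite big_nat_recr; last by lia.
by rewrite /= IH//; lia.
Qed.

Lemma alternating_tau2 n s : (2 <= n)%N ->
  alternating_points n (1 / n%:R) s -> `|tau2 n s - 4| <= 36 / n%:R.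
Proof.
move=> n2 sP.
have n0 : 0 < n%:R :> R by rewrite ltr0n; lia.
set g : R := 1 / n%:R in sP *.
have g0 : 0 < g by rewrite divr_gt0.
have g1 : g < 1 by rewrite ltr_pdivrMr// mul1r ltr1n.
have ds : design n s by apply: alternating_design sP => //; rewrite g0.
(* The summand is 4 - 6g + 2g^2 for odd i and 2g + 2g^2 for even i, so [6 * g] bounds its distance
   to 4 or 0. The one exception is i = n - 1, whose right neighbour is the irregular last spacing;
   there the distance is at most 6. *)
have -> : 36 / n%:R = 2 * (6 * g) + (2 * 6 * 1 + 12) / n%:R :> R.
  by rewrite /g; field; rewrite gt_eqF.
apply: (@dist_tau2_le _ _ _ (fun i => i == n.-1) 1%N (fun i => 4 * (odd i)%:R)).
- by lia.
- lra.
- lra.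
- move=> i i3n; have [ein|nin] := eqVneq i n.-1.
    have /andP[t0 t6] := tau2_term_bound ds i3n.
    by case: (odd i) => /=; rewrite ler_norml; apply/andP; split; lra.
  case: sP => _ sE _.
  have c0 : 0 < 2 / n%:R :> R by rewrite divr_gt0.
  have E2 : 2 * g / n%:R = g * (2 / n%:R) by rewrite mulrAC mulrC.
  have Di := sE i ltac:(lia).
  have Dp := sE i.-1 ltac:(lia).
  have Dn := sE i.+1 ltac:(lia).
  have oi : odd i.-1 = ~~ odd i by lia.
  rewrite /= E2 ?oi in Di Dp Dn.
  have [io|ie] := boolP (odd i); rewrite ?io ?(negbTE ie) /= in Di Dp Dn.
    rewrite (@tau2_termE _ _ _ (1 - g) (1 - g)) ?Di ?Dp ?Dn.
    + by rewrite /= ler_norml; apply/andP; split; nra.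
    + by rewrite -mulrDl gt_eqF// mulr_gt0//; lra.
    + by rewrite -mulrDl gt_eqF// mulr_gt0//; lra.
    + by ring.
    + by ring.
  rewrite (@tau2_termE _ _ _ g g) ?Di ?Dp ?Dn.
  + by rewrite /= ler_norml; apply/andP; split; nra.
  + by rewrite -mulrDl gt_eqF// mulr_gt0//; lra.
  + by rewrite -mulrDl gt_eqF// mulr_gt0//; lra.
  + by ring.
  + by ring.
- have [n3|n3] := leqP 3 n.-1; last by rewrite big_nat big1// => i; lia.
  have -> : n = n.-1.+1 by lia.
  rewrite big_nat_recr//= eqxx big_nat big1// => i; lia.
(* There are h - 1 odd indices, and 8(h - 1) - 4n is -8 or -12 according to the parity of n; hence
   the 12. *)
- rewrite -mulr_sumr -natr_sum sum_odd//.
  have := odd_double_half n; set h := n./2 => nE.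
  have h1 : (1 <= h)%N by lia.
  rewrite -[in n%:R]nE natrD -muln2 natrM -subn1 natrB//.
  by case: (odd n) => /=; rewrite ler_norml; apply/andP; split; lra.
Qed.

End Alternating.

(** * Part (ii): factorial spacings after a constant block *)

Section Factorial.
Variable R : realType.
Implicit Types (s : nat -> R) (n m i : nat).

(* [1 / i! <= 1 / (i (i - 1)) = 1 / (i - 1) - 1 / i] telescopes. *)
Lemma sum_inv_fact_le m n : (1 <= m <= n)%N ->
  \sum_(m.+1 <= i < n.+1) (1 / (i`!)%:R : R) <= m%:R^-1 - n%:R^-1.
Proof.
case: m => // m /= mn.
have fK k : (m < k)%N -> k%:R != 0 :> R by move=> ?; rewrite pnatr_eq0; lia.
rewrite (_ : m.+1%:R^-1 - _ =
    \sum_(m.+2 <= i < n.+1) (- i%:R^-1 - (- i.-1%:R^-1))); last first.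
  by rewrite (telescope_sumr_eq (fun i => - i.-1%:R^-1))//=; ring.
apply: ler_sum_nat => -[//|[//|i]] /andP[mi _].
rewrite !factS /= (_ : - i.+2%:R^-1 - _ = 1 / (i.+2%:R * i.+1%:R)); last first.
  field.
  by rewrite nat1r -natrD !pnatr_eq0.
rewrite ler_pM2l// lef_pV2 ?posrE -?natrM ?ltr0n ?muln_gt0 ?fact_gt0//.
by rewrite ler_nat leq_mul// leq_pmulr// fact_gt0.
Qed.

Lemma factorial_design n m s : (2 <= m <= n)%N ->
  factorial_points n m s ->
  design n s /\ \sum_(2 <= i < n.+1) spacing s i = 1.
Proof.
move=> m2n [s1 sf sc].
set r := \sum_(m.+1 <= i < n.+1) spacing s i in sc.
have m0 : 1 < m%:R :> R by rewrite ltr1n; lia.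
(* This makes the spacings of the constant block positive. *)
have r1 : r < 1.
  rewrite /r (eq_big_nat _ _ (F2 := fun i => 1 / (i`!)%:R)); last first.
    by move=> i ?; apply: sf; lia.
  apply: (le_lt_trans (sum_inv_fact_le _)); first by lia.
  apply: (@le_lt_trans _ _ m%:R^-1); first by rewrite gerBl invr_ge0.
  by rewrite invf_lt1//; lra.
have sum1 : \sum_(2 <= i < n.+1) spacing s i = 1.
  rewrite (@big_cat_nat _ _ _ m.+1) /=; [|lia|lia].
  rewrite -/r (eq_big_nat _ _ (F2 := fun=> (1 - r) / (m%:R - 1))); last first.
    by move=> i ?; apply: sc; lia.
  rewrite sumr_const_nat subSS -[_ / _ *+ _]mulr_natr natrB; last by lia.
  by rewrite divfK ?subrK// subr_eq0 gt_eqF.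
split=> //; apply: design_spacing => //; first by lia.
move=> i i2n; have [im|im] := leqP i m.
  by rewrite sc ?divr_gt0 ?subr_gt0//; lia.
by rewrite sf ?divr_gt0 ?ltr0n ?fact_gt0//; lia.
Qed.

Lemma factorial_tau2 n m s : (2 <= m <= n)%N ->
  factorial_points n m s ->
  `|tau2 n s - 2| <= 4 / m%:R + (12 * m%:R + 30) / n%:R.
Proof.
move=> m2n sP.
have [ds _] := factorial_design m2n sP.
have m0 : 0 < m%:R :> R by rewrite ltr0n; lia.
(* From i = m + 2 on, the spacings i - 1, i and i + 1 are all factorial and the error is at most
   2/m; the smaller indices are exceptional. The final 6 comes from the sum having n - 3 terms: 2(n
   - 3) - 2n = -6. *)
have -> : 4 / m%:R + (12 * m%:R + 30) / n%:R
    = 2 * (2 / m%:R) + (2 * 6 * m.+2%:R + 6) / n%:R :> R.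
  by rewrite -addn2 natrD mulrA -natrM; congr (_ + _ / _); ring.
apply: (@dist_tau2_le _ _ _ (fun i => (i < m.+2)%N) m.+2 (fun=> 1)).
- by lia.
- by rewrite divr_ge0// ltW.
- lra.
- move=> i i3n; have [im|im] := ltnP i m.+2.
    have /andP[t0 t6] := tau2_term_bound ds i3n.
    have : 0 <= 2 / m%:R :> R by rewrite divr_ge0// ltW.
    by rewrite /= => ?; rewrite ler_norml; apply/andP; split; lra.
  rewrite /= mulr0 addr0.
  case: sP => _ sf _.
  case: i i3n im => // j i3n im.
  have f0 : 0 < (j`!)%:R :> R by rewrite ltr0n fact_gt0.
  have Dp : spacing s j = 1 / (j`!)%:R by apply: sf; lia.
  have Di : spacing s j.+1 = 1 / (j.+1%:R * (j`!)%:R).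
    by rewrite -natrM -factS; apply: sf; lia.
  have Dn : spacing s j.+2 = 1 / (j.+2%:R * (j.+1%:R * (j`!)%:R)).
    by rewrite -!natrM -!factS; apply: sf; lia.
  have mj : m%:R <= j%:R :> R by rewrite ler_nat; lia.
  rewrite -!natr1 in Di Dn.
  move: (j%:R) (j`!%:R) (m%:R) f0 m0 mj Dp Di Dn => J f M f0 M0 MJ Dp Di Dn.
  have J0 : 0 < J by lra.
  have f_neq0 : f != 0 by rewrite gt_eqF.
  have J1 : J + 1 != 0 by rewrite gt_eqF//; lra.
  have J2 : J + 1 + 1 != 0 by rewrite gt_eqF//; lra.
  have J3 : J + 3 != 0 by rewrite gt_eqF//; lra.
  have Dp0 : 0 < spacing s j by rewrite Dp divr_gt0.
  have Di0 : 0 < spacing s j.+1 by rewrite Di divr_gt0 ?mulr_gt0//; lra.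
  have Dn0 : 0 < spacing s j.+2 by rewrite Dn divr_gt0 ?mulr_gt0//; lra.
  rewrite (@tau2_termE _ _ _ (J + 3)^-1 ((J + 1) / (J + 2))) /=.
  (* The summand minus 1 is (1 - (w - v))^2 - 1 + 2v(1 - v). As 0 < v <= w <= 1, it lies between -2w
     and 2w, and w <= 1/M. *)
  + set v := (J + 3)^-1.
    have -> : (J + 1) / (J + 2) = 1 - (J + 2)^-1.
      by field; rewrite gt_eqF//; lra.
    set w := (J + 2)^-1.
    have v0 : 0 < v by rewrite invr_gt0; lra.
    have vw : v <= w by rewrite lef_pV2 ?posrE; lra.
    have wM : w <= M^-1 by rewrite lef_pV2 ?posrE; lra.
    have w1 : w <= 1 by rewrite invf_le1; lra.
    by rewrite ler_norml; apply/andP; split; nra.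
  + by rewrite gt_eqF// addr_gt0.
  + by rewrite gt_eqF// addr_gt0.
  + by rewrite Di Dn; field; rewrite f_neq0 J1 J2 J3.
  + by rewrite Di Dp; field; rewrite f_neq0 J1 gt_eqF//; lra.
- have [n3|n3] := leqP 3 n; last by rewrite big_geq//; lia.
  rewrite -big_mkcond /= sum1_count.
  apply: (@leq_trans (size (iota 0 m.+2))); last by rewrite size_iota.
  rewrite -size_filter; apply: uniq_leq_size.
    exact: filter_uniq (iota_uniq _ _).
  by move=> i; rewrite mem_filter mem_iota /= => /andP[].
- have [n3|n3] := leqP 3 n.
    rewrite sumr_const_nat natrB// ler_norml.
    by apply/andP; split; lra.
  rewrite big_geq; last by lia.
  have : n%:R <= 3 :> R by rewrite (ler_nat _ n 3); lia.
  have : 0 <= n%:R :> R by [].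
  by move=> ? ?; rewrite ler_norml; apply/andP; split; lra.
Qed.

End Factorial.

(** * Size of the integer part of n^alpha *)

Section FloorPower.
Variable R : realType.
Implicit Types (alpha : R) (n : nat).

Lemma floor_power_le alpha n : (floor_power alpha n)%:R <= n%:R `^ alpha.
Proof. by rewrite /floor_power truncn_le powR_ge0. Qed.

Lemma floor_power_leq alpha n : 0 < alpha < 1 ->
  (2 <= floor_power alpha n)%N ->
  (floor_power alpha n <= n)%N.
Proof.
move=> /andP[a0 a1]; case: n => [|n].
  by rewrite /floor_power powR0 ?gt_eqF// truncn0.
move=> _; rewrite -(ler_nat R); apply: (le_trans (floor_power_le _ _)).
by rewrite ler1_powR ?ler1n// ltW.
Qed.

(** With m of order n^alpha, 1/m decays like n^(-alpha) and m/n like n^(-(1 - alpha)); the slower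
    decay sets the exponent. *)
Lemma floor_power_rate alpha n : 0 < alpha < 1 -> (0 < n)%N ->
  2 <= n%:R `^ alpha ->
  4 / (floor_power alpha n)%:R
    + (12 * (floor_power alpha n)%:R + 30) / n%:R
  <= 50 / n%:R `^ Num.min alpha (1 - alpha).
Proof.
move=> /andP[a0 a1] n0 na2.
set b := Num.min _ _; set m := floor_power _ _.
have n1R : 1 <= n%:R :> R by rewrite ler1n.
have n0R : 0 < n%:R :> R by rewrite ltr0n.
have nb0 : 0 < n%:R `^ b by rewrite powR_gt0.
have na0 : 0 < n%:R `^ alpha by rewrite powR_gt0.
have nac0 : 0 < n%:R `^ (1 - alpha) by rewrite powR_gt0.
have /andP[mle mgt] : m%:R <= n%:R `^ alpha < m%:R + 1.
  by rewrite natr1 truncn_itv// powR_ge0.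
have nab : n%:R = n%:R `^ alpha * n%:R `^ (1 - alpha).
  by rewrite -powRD ?subrKC ?powRr1// gt_eqF// implybT.
have ba : n%:R `^ b <= n%:R `^ alpha by rewrite ler_powR// ge_min lexx.
have bac : n%:R `^ b <= n%:R `^ (1 - alpha).
  by rewrite ler_powR// ge_min lexx orbT.
(* From m > n^alpha - 1 and n^alpha >= 2 follows m >= n^alpha / 2. *)
have t1 : 4 / m%:R <= 8 / n%:R `^ b.
  rewrite ler_pdivrMr; last by lra.
  by rewrite mulrAC ler_pdivlMr//; lra.
(* Since m <= n^alpha and 1 <= n^alpha, the numerator is at most 42 n^alpha. *)
have t2 : (12 * m%:R + 30) / n%:R <= 42 / n%:R `^ b.
  rewrite ler_pdivrMr// mulrAC ler_pdivlMr//.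
  rewrite [X in _ <= _ * X]nab.
  move: mle ba bac na2 nb0; rewrite -/m.
  have := ler0n R m.
  move: (n%:R `^ b) (n%:R `^ alpha) (n%:R `^ (1 - alpha)) (m%:R) => B A C M.
  by move=> *; nra.
have -> : 50 / n%:R `^ b = 8 / n%:R `^ b + 42 / n%:R `^ b.
  by rewrite -mulrDl -natrD.
exact: lerD.
Qed.

End FloorPower.

(** * Both limits from their rates *)

Theorem proposition4p5 (R : realType) :
  (forall (gamma : nat -> R) (s : nat -> nat -> R),
     (forall n, (2 <= n)%N -> 0 < gamma n < 1) ->
     (forall n, (2 <= n)%N -> alternating_points n (gamma n) (s n)) ->
     (forall n, (2 <= n)%N -> design n (s n)) /\
     ((forall n, (2 <= n)%N -> gamma n = 1 / n%:R) ->
      (fun n => tau2 n (s n)) @ \oo --> (4 : R)))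
  /\
  (forall (alpha : R) (s : nat -> nat -> R),
     0 < alpha < 1 ->
     (forall n, (2 <= floor_power alpha n)%N ->
        factorial_points n (floor_power alpha n) (s n)) ->
     (forall n, (2 <= floor_power alpha n)%N ->
        design n (s n) /\ \sum_(2 <= i < n.+1) spacing (s n) i = 1) /\
     (fun n => tau2 n (s n)) @ \oo --> (2 : R)).
Proof.
split=> [gamma s gamma01 sP|alpha s alpha01 sP]; split.
- by move=> n n2; apply: alternating_design (sP n n2); rewrite ?gamma01.
- move=> gammaE; apply: (@cvg_power_rate _ _ _ 36 1) => //.
  near=> n; have n2 : (2 <= n)%N by near: n; exact: nbhs_infty_ge.
  by rewrite powRr1// alternating_tau2// -gammaE//; exact: sP.
- move=> n m2; apply: factorial_design (sP n m2).
  by rewrite m2 floor_power_leq.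
- have /andP[a0 a1] := alpha01.
  apply: (@cvg_power_rate _ _ _ 50 (Num.min alpha (1 - alpha))).
    by rewrite lt_min a0 subr_gt0.
  near=> n.
  have na2 : 2 <= n%:R `^ alpha by near: n; exact: near_powR_ge.
  have m2 : (2 <= floor_power alpha n)%N.
    by rewrite /floor_power truncn_ge_nat ?powR_ge0.
  apply: le_trans (floor_power_rate alpha01 _ na2).
    by apply: factorial_tau2 (sP n m2); rewrite m2 floor_power_leq.
  by near: n; exact: nbhs_infty_gt.
Unshelve. all: by end_near. Qed.
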